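(* Let $k\ge3$, let $s\ge0$ be an integer, and let $\mathbf F$ be a satisfiable $(\le k)$-CNF formula that is $s$-implication free. For $l$ chosen uniformly at random from $\mathrm{SL}(\mathbf F)$, \[\mathbb E_l\big[c(\mathbf F^{[l]})\big]\le c(\mathbf F)-n_N(\mathbf F)\frac{2S}{|\mathrm{SL}(\mathbf F)|}-n_C(\mathbf F)\frac{1}{|\mathrm{SL}(\mathbf F)|}.\]
   Context: A literal is a variable $x$ or its negation $\bar x$; a clause is a finite set of literals over pairwise distinct variables; a CNF formula $\mathbf F=(F,V)$ has variable set $V(\mathbf F)=V$ (finite), $n(\mathbf F)=|V|$, and a finite set $F$ of clauses over $V$; it is $(\le k)$-CNF if all clauses have at most $k$ literals. Assignments on $V$ are maps $V\to\{0,1\}$, identified with the set of literals they satisfy; $\mathrm{sat}(\mathbf F)$ is the set of satisfying assignments on $V(\mathbf F)$. For a literal $l$ over $y\in V(\mathbf F)$, $\mathbf F^{[l]}$ deletes clauses containing $l$, deletes $\bar l$ from clauses, and removes $y$ from the variable set. A literal $l$ over $V(\mathbf F)$ is $s$-implied by $\mathbf F$ if there is $G\subseteq F$ with $|G|\le s$ such that every assignment on $V$ satisfying all clauses of $G$ satisfies $l$; $\mathbf F$ is $s$-implication free if no literal is $s$-implied. $\mathrm{PPSZ}(\mathbf F,\beta,\pi,s)$, for an assignment $\beta$ and a permutation $\pi$ of $V(\mathbf F)$: for each variable $x$ in the order $\pi$: (i) while the current formula has an $s$-implied literal, restrict the current formula to it; (ii) then, if $x$ is still a variable of the current formula, restrict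 it by $x\mapsto\beta(x)$; $x$ is then called guessed. For $\alpha\in\mathrm{sat}(\mathbf F)$, $p_{\mathrm{guessed}}(\mathbf F,x,\alpha,s)$ is the probability over uniform $\pi$ that $x$ is guessed in $\mathrm{PPSZ}(\mathbf F,\alpha,\pi,s)$ ($\alpha$ restricted to $V(\mathbf F)$ if defined on a superset; $0$ if $x\notin V(\mathbf F)$). A variable $x\in V(\mathbf F)$ is frozen if all satisfying assignments of $\mathbf F$ agree on $x$, non-frozen otherwise; $n_N(\mathbf F)$ and $n_C(\mathbf F)$ are the numbers of non-frozen and frozen variables. $\mathrm{SL}(\mathbf F)$ is the set of literals $l$ over $V(\mathbf F)$ with $\mathbf F^{[l]}$ satisfiable. AssignSatisfiableLiterals$(\mathbf F)$: start with the empty assignment; while $V(\mathbf F)\neq\emptyset$, choose $l$ uniformly from $\mathrm{SL}(\mathbf F)$, add it, and set $\mathbf F\leftarrow\mathbf F^{[l]}$; output the assignment. $p(\mathbf F,\alpha)$ is the probability that it outputs $\alpha$ (restricted to $V(\mathbf F)$ if $\alpha$ is on a superset). Cost: let $S_k:=\int_0^1\frac{t^{1/(k-1)}-t}{1-t}\,dt$ and let $S$ be a real number with $S\ge S_k$ such that $p_{\mathrm{guessed}}(\mathbf F',x,\alpha,s)\le S$ for every satisfiable $(\le k)$-CNF $\mathbf F'$, every frozen $x$ of $\mathbf F'$ and every $\alpha\in\mathrm{sat}(\mathbf F')$. Define $c(\mathbf F,x)=0$ if $x\notin V(\mathbf F)$; $c(\mathbf F,x)=S$ if $x$ is non-frozen;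 $c(\mathbf F,x)=\sum_{\alpha\in\mathrm{sat}(\mathbf F)}p(\mathbf F,\alpha)\,p_{\mathrm{guessed}}(\mathbf F,x,\alpha,s)$ if $x$ is frozen; $c(\mathbf F):=\sum_{x\in V(\mathbf F)}c(\mathbf F,x)$. *)

(* Defs.v *)
From HB Require Import structures.
From mathcomp Require Import all_boot all_order all_algebra.
From mathcomp Require Import all_classical all_reals all_analysis.

Set Implicit Arguments.
Unset Strict Implicit.
Unset Printing Implicit Defensive.

Import Order.TTheory GRing.Theory Num.Theory.

Local Open Scope ring_scope.

(* Variables are the elements of a finite type T; a formula
   carries its own variable set V, a subset of T. *)

(* (x, true) is the literal x and (x, false) its negation. *)
Notation literal T := (T * bool)%type.
Notation clause T := {set literal T}.

(* A 0/1-assignment is the set of the literals it satisfies. *)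
Notation assignment T := {set literal T}.

Section Formulas.
Variable T : finType.

Definition negl (l : literal T) : literal T := (l.1, ~~ l.2).

Definition clause_over (V : {set T}) (C : clause T) : bool :=
  [forall l in C, (l.1 \in V) && (negl l \notin C)].

Record cnf := Cnf {
  vars : {set T};
  clauses : {set clause T};
  clausesP : [forall C in clauses, clause_over vars C]
}.

Definition is_kcnf (k : nat) (F : cnf) : bool :=
  [forall C in clauses F, #|C| <= k]%N.

(* a is a total assignment on V: no literal outside V, and exactly one of
   l, negl l for each literal l over V. *)
Definition assignment_on (V : {set T}) (a : assignment T) : bool :=
  [forall l : literal T, (l \in a) == (l.1 \in V) && (negl l \notin a)].

Definition restrict_assignment (V : {set T}) (a : assignment T) :
  assignment T := [set l in a | l.1 \in V].

Definition satisfies (a : assignment T) (G : {set clause T}) : bool :=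
  [forall C in G, [exists l in C, l \in a]].

Definition sat (F : cnf) : {set assignment T} :=
  [set a : assignment T | assignment_on (vars F) a && satisfies a (clauses F)].

Definition satisfiable (F : cnf) : bool := sat F != finset.set0.

Definition restrict_clauses (F : cnf) (l : literal T) : {set clause T} :=
  [set C :\ negl l | C in [set C in clauses F | l \notin C]].

Lemma restrict_clausesP (F : cnf) (l : literal T) :
  [forall C in restrict_clauses F l, clause_over (vars F :\ l.1) C].
Proof.
apply/forall_inP => D /imsetP[C]; rewrite inE => /andP[CF lC ->].
apply/forall_inP => m; rewrite !inE => /andP[mNl mC].
have /forall_inP/(_ C CF)/forall_inP/(_ m mC)/andP[mV mNC] := clausesP F.
rewrite mV (negbTE mNC) !andbF !andbT.
apply: contraNneq mNl => ml.
case: l m lC {mV mNC} ml mC => [x b] [y c] /= lC -> mC.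
rewrite /negl xpair_eqE eqxx /=.
by case: b c lC mC => [] [] // /negP.
Qed.

(* F^[l] *)
Definition restrict_cnf (F : cnf) (l : literal T) : cnf :=
  Cnf (restrict_clausesP F l).

Definition implied (s : nat) (F : cnf) (l : literal T) : bool :=
  (l.1 \in vars F) &&
  [exists G : {set clause T},
    [&& G \subset clauses F, (#|G| <= s)%N &
      [forall a : assignment T,
        assignment_on (vars F) a && satisfies a G ==> (l \in a)]]].

Definition implication_free (s : nat) (F : cnf) : bool :=
  [forall l : literal T, ~~ implied s F l].

(* Step (i).  Every restriction removes a variable, so #|vars F| rounds exhaust
   the loop.  The loop leaves open which implied literal is taken: [pick] fixes
   a choice.  When the guesses come from a satisfying assignment, all implied
   literals are true in it and literals stay implied under restriction, so the
   resulting formula does not depend on the choice. *)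
Definition propagate (s : nat) (F : cnf) : cnf :=
  iter #|vars F|
    (fun F' => if [pick l | implied s F' l] is Some l then restrict_cnf F' l
               else F')
    F.

(* The set of variables guessed by PPSZ(F, b, xs, s), the permutation being
   given as the sequence xs in which it lists the variables. *)
Fixpoint ppsz_guessed (F : cnf) (b : assignment T) (xs : seq T) (s : nat) :
    {set T} :=
  if xs is x :: xs' then
    let F' := propagate s F in
    if x \in vars F' then
      x |: ppsz_guessed (restrict_cnf F' (x, (x, true) \in b)) b xs' s
    else ppsz_guessed F' b xs' s
  else finset.set0.

Definition frozen (F : cnf) (x : T) : bool :=
  (x \in vars F) &&
  [forall a in sat F, forall b in sat F,
    ((x, true) \in a) == ((x, true) \in b)].

Definition nC (F : cnf) : nat := #|[set x in vars F | frozen F x]|.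
Definition nN (F : cnf) : nat := #|[set x in vars F | ~~ frozen F x]|.

Definition SL (F : cnf) : {set literal T} :=
  [set l : literal T | (l.1 \in vars F) && satisfiable (restrict_cnf F l)].

Section Probabilities.
Variable R : realType.

Definition p_guessed (F : cnf) (x : T) (a : assignment T) (s : nat) : R :=
  if x \in vars F then
    let orders := permutations (enum (vars F)) in
    (count (fun xs =>
        x \in ppsz_guessed F (restrict_assignment (vars F) a) xs s) orders)%:R
    / (size orders)%:R
  else 0.

(* The probability that n rounds of AssignSatisfiableLiterals, from the current
   formula F and the current partial assignment b, end with the assignment a. *)
Fixpoint asl_prob (n : nat) (F : cnf) (b a : assignment T) : R :=
  if n is n'.+1 then
    (\sum_(l in SL F) asl_prob n' (restrict_cnf F l) (l |: b) a) / #|SL F|%:R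
  else (b == a)%:R.

(* Each round removes one variable, so the loop makes #|vars F| rounds. *)
Definition p_asl (F : cnf) (a : assignment T) : R :=
  asl_prob #|vars F| F finset.set0 (restrict_assignment (vars F) a).

Definition cost_var (s : nat) (S : R) (F : cnf) (x : T) : R :=
  if x \notin vars F then 0
  else if frozen F x then
    \sum_(a in sat F) p_asl F a * p_guessed F x a s
  else S.

Definition cost (s : nat) (S : R) (F : cnf) : R :=
  \sum_(x in vars F) cost_var s S F x.

(* The expectation of f l for l uniform in SL(F); it is 0 when SL(F) is empty,
   which for satisfiable F happens only if F has no variables. *)
Definition expect_SL (F : cnf) (f : literal T -> R) : R :=
  (\sum_(l in SL F) f l) / #|SL F|%:R.

End Probabilities.
End Formulas.

(* At t = 1 the integrand is 0 / 0 = 0, which does not affect the integral. *)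
Definition S_const (R : realType) (k : nat) : R :=
  \int[@lebesgue_measure R]_(t in `[0, 1]%classic)
    ((t `^ (k.-1%:R)^-1 - t) / (1 - t)).

(* S is an admissible value for the cost of a non-frozen variable. *)
Definition guess_bound (R : realType) (k s : nat) (S : R) : Prop :=
  S_const R k <= S /\
  forall (T : finType) (F : cnf T) (x : T) (a : assignment T),
    satisfiable F -> is_kcnf k F -> frozen F x -> a \in sat F ->
    p_guessed R F x a s <= S.

(* Main.v *)
Require Import Defs.
From mathcomp Require Import all_boot all_order all_algebra.
From mathcomp Require Import all_classical all_reals all_analysis.

(* Fix a satisfying assignment a and let l_z be the literal of z true in a.
   Since F is implication free, PPSZ guesses its first variable, whence
   |V(F)| pg(F,x,a) = 1 + sum_z pg(F^[l_z],x,a) for x in V(F); likewise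
   |SL(F)| p(F,a) = sum_z p(F^[l_z],a).  Restriction to l_z can only lower
   pg(-,x,a), because implied literals stay implied, and can only raise p(-,a),
   because it shrinks SL.  Hence, for frozen x, the nonnegative drops
   pg(F,x,a) - pg(F^[l_z],x,a), whose sum over z is 1, weighted by
   p(F^[l_z],a) >= p(F,a), add up to at least p(F,a), and the p(F,a) sum to 1
   over a.  For non-frozen x, both literals of x lie in SL(F) and bring the cost
   from S to 0, while the other literals do not increase it. *)

Import Order.TTheory GRing.Theory Num.Theory.

Local Open Scope ring_scope.

Section Restriction_costs.

(* all_classical shadows lemmas of these two files, such as subsetP and setDDl. *)
Import mathcomp.boot.fintype mathcomp.boot.finset.
Set Implicit Arguments.
Unset Strict Implicit.

Variable T : finType.
Implicit Types (F G H : cnf T) (a b : assignment T) (l m : literal T).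
Implicit Types (V : {set T}) (x y z : T).

Local Notation lit a x := (x, (x, true) \in a).

(** * Literals, restriction and satisfying assignments *)

Lemma eq_var_literal l m : m.1 = l.1 -> m = l \/ m = negl l.
Proof. by case: l m => [x []] [y []] /= ->; [left | right | right | left]. Qed.

Lemma cnf_eq F G : vars F = vars G -> clauses F = clauses G -> F = G.
Proof.
case: F G => [V C CP] [W D DP] /= VW CD; case: W / VW DP => DP.
by case: D / CD DP => DP; congr Cnf; apply: bool_irrelevance.
Qed.

Lemma card_vars_restrict F l : l.1 \in vars F ->
  #|vars (restrict_cnf F l)| = #|vars F|.-1.
Proof. by move=> lF; rewrite [#|vars F|](cardsD1 l.1) lF. Qed.

Lemma restrictC F l m : l.1 != m.1 ->
  restrict_cnf (restrict_cnf F l) m = restrict_cnf (restrict_cnf F m) l.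
Proof.
move=> lm; apply: cnf_eq => /=; first by rewrite !setDDl setUC.
(* The two orders of restriction play symmetric roles, so one inclusion suffices. *)
suff sub l' m' : l'.1 != m'.1 ->
    restrict_clauses (restrict_cnf F l') m' \subset
    restrict_clauses (restrict_cnf F m') l'.
  by apply/eqP; rewrite eqEsubset !sub // eq_sym.
move=> {l m lm} lm; apply/subsetP => C /imsetP[D].
rewrite inE => /andP[/imsetP[E]]; rewrite inE => /andP[EF lE] -> mE ->.
have neq : m' != negl l' by apply: contraNneq lm => ->.
have neq' : l' != negl m' by apply: contraNneq lm => ->.
apply/imsetP; exists (E :\ negl m'); last first.
  by rewrite !setDDl setUC.
rewrite !inE neq' /= (negbTE lE) andbT; apply/imsetP; exists E => //.
by rewrite inE EF; move: mE; rewrite !inE neq.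
Qed.

(* [a] may contain literals over variables outside [vars F], so that a single
   assignment can be followed through all restrictions of [F]. *)
Definition models a F :=
  [forall l : literal T, (l.1 \in vars F) ==> ((l \in a) == (negl l \notin a))]
  && satisfies a (clauses F).

Lemma modelsP a F :
  reflect ((forall l, l.1 \in vars F -> (l \in a) = (negl l \notin a)) /\
           (forall C, C \in clauses F -> exists2 l, l \in C & l \in a))
          (models a F).
Proof.
apply: (iffP andP) => [[/forallP tot /forall_inP sat]|[tot sat]]; split.
- by move=> l lF; apply/eqP; move/implyP: (tot l); apply.
- by move=> C /sat/exists_inP.
- by apply/forallP => l; apply/implyP => lF; apply/eqP/tot.
- by apply/forall_inP => C CF; apply/exists_inP/sat.
Qed.

Lemma clause_vars F C l : C \in clauses F -> l \in C -> l.1 \in vars F.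
Proof.
by move=> CF lC; have /forall_inP/(_ C CF)/forall_inP/(_ l lC)/andP[] := clausesP F.
Qed.

Lemma assignment_onP V a :
  reflect (forall l, (l \in a) = (l.1 \in V) && (negl l \notin a))
          (assignment_on V a).
Proof. by apply: (iffP forallP) => h l; apply/eqP; rewrite h. Qed.

Lemma satE a F : (a \in sat F) = assignment_on (vars F) a && models a F.
Proof.
rewrite inE /models; case: assignment_onP => //= aF.
suff -> : [forall l, (l.1 \in vars F) ==> ((l \in a) == (negl l \notin a))] by [].
by apply/forallP => l; apply/implyP => lF; rewrite aF lF.
Qed.

Lemma sat_models a F : a \in sat F -> models a F.
Proof. by rewrite satE => /andP[]. Qed.

Lemma mem_sat a F l : a \in sat F ->
  (l \in a) = (l.1 \in vars F) && (negl l \notin a).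
Proof. by rewrite satE => /andP[/assignment_onP]. Qed.

Lemma models_sat a F : models a F -> restrict_assignment (vars F) a \in sat F.
Proof.
move=> aF; have /modelsP[tot sat] := aF; rewrite satE; apply/andP; split.
  apply/assignment_onP => l; rewrite !inE /=.
  by case: (boolP (l.1 \in vars F)) => lF; rewrite !(andbT, andbF) //= tot.
apply/modelsP; split=> [l lF|C CF]; first by rewrite !inE /= lF !andbT tot.
by have [l lC la] := sat C CF; exists l; rewrite // inE la (clause_vars CF).
Qed.

Lemma models_eq a F l m : models a F -> l.1 \in vars F ->
  l \in a -> m \in a -> m.1 = l.1 -> m = l.
Proof.
move=> /modelsP[tot _] lF la ma /eq_var_literal[//|ml].
by move: la; rewrite tot // -ml ma.
Qed.

Lemma models_restrict a F l : l.1 \in vars F -> l \in a -> models a F ->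
  models a (restrict_cnf F l).
Proof.
move=> lF la /modelsP[tot sat]; apply/modelsP; split=> [m|C].
  by rewrite inE => /andP[_ /tot].
move=> /imsetP[D]; rewrite inE => /andP[/sat[m mD ma] lD] ->.
exists m => //; rewrite !inE mD andbT; apply: contraTneq ma => ->.
by rewrite -tot.
Qed.

(** A clause containing [l] is satisfied by [l] itself; any other clause survives restriction, and
    [b] already satisfies its trimmed form. *)
Lemma lift_satisfies (Gs : {set clause T}) l b :
  satisfies b [set C :\ negl l | C in [set C in Gs | l \notin C]] ->
  satisfies (l |: b) Gs.
Proof.
move=> /forall_inP sat; apply/forall_inP => C CG; apply/exists_inP.
case: (boolP (l \in C)) => lC; first by exists l; rewrite ?setU11.
have /exists_inP[m] : [exists m in C :\ negl l, m \in b].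
  by apply: sat; apply: imset_f; rewrite inE CG.
by rewrite inE => /andP[_ mC] mb; exists m; rewrite // inE mb orbT.
Qed.

Lemma lift_assignment_on V l b : l.1 \in V ->
  assignment_on (V :\ l.1) b -> assignment_on V (l |: b).
Proof.
move=> lV /assignment_onP bV; apply/assignment_onP => m; rewrite !inE negb_or.
case: (eqVneq m.1 l.1) => [ml|ml].
  have mb : m \in b = false by rewrite bV !inE ml eqxx.
  have nmb : negl m \in b = false by rewrite bV !inE /= ml eqxx.
  rewrite mb nmb orbF andbT ml lV /=.
  by case: (eq_var_literal ml) => ->; case: (l) => x [];
     rewrite /negl !xpair_eqE eqxx.
have -> : (m == l) = false by apply: contra_neqF ml => /eqP ->.
have -> : (negl m == l) = false by apply: contra_neqF ml => /eqP <-.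
by rewrite /= bV !inE ml.
Qed.

Lemma implied_true s a F l : models a F -> implied s F l -> l \in a.
Proof.
move=> aF /andP[_ /existsP[Gs /and3P[GF _]]].
move=> /forallP/(_ (restrict_assignment (vars F) a)).
have := models_sat aF; rewrite inE => /andP[-> /forall_inP sat] /=.
have -> : satisfies (restrict_assignment (vars F) a) Gs.
  by apply/forall_inP => C CG; apply: sat; apply: (subsetP GF).
by rewrite inE => /andP[].
Qed.

(** The trimmed clauses of the witness set are again a witness, of no larger size: an assignment [b]
    satisfying them lifts to [l |: b], which must contain [m], and [m] cannot be [l]. *)
Lemma implied_restrict s F l m : l.1 \in vars F -> m.1 != l.1 ->
  implied s F m -> implied s (restrict_cnf F l) m.
Proof.
move=> lF ml /andP[mF /existsP[Gs /and3P[GF Gs_s /forallP imp]]].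
apply/andP; split; first by rewrite !inE ml.
apply/existsP; exists [set C :\ negl l | C in [set C in Gs | l \notin C]].
apply/and3P; split.
- by apply: imsetS; apply/subsetP => C; rewrite !inE => /andP[/(subsetP GF) ->].
- apply: leq_trans (leq_imset_card _ _) (leq_trans _ Gs_s).
  by apply: subset_leq_card; apply/subsetP => C; rewrite inE => /andP[].
- apply/forallP => b; apply/implyP => /andP[bF bG].
  have /implyP := imp (l |: b); rewrite lift_assignment_on // lift_satisfies //.
  move=> /(_ isT); rewrite !inE => /orP[/eqP ml'|//].
  by rewrite ml' eqxx in ml.
Qed.

(** This relation is the invariant for comparing PPSZ runs led by the same [a]: restricting further
    to literals of [a] preserves both being modelled by [a] and, for the variables that remain,
    being implied. *)
Inductive reach a : cnf T -> cnf T -> Prop :=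
| reach_refl F : reach a F F
| reach_step F l H : l.1 \in vars F -> l \in a ->
    reach a (restrict_cnf F l) H -> reach a F H.

Lemma reach_trans a F G H : reach a F G -> reach a G H -> reach a F H.
Proof.
by move=> FG; elim: FG H => // {}F l {}G lF la _ IH H /IH; apply: reach_step.
Qed.

Lemma reach1 a F l : l.1 \in vars F -> l \in a -> reach a F (restrict_cnf F l).
Proof. by move=> lF la; apply: reach_step lF la (reach_refl _ _). Qed.

Lemma reach_models a F H : reach a F H -> models a F -> models a H.
Proof. by elim=> // {}F l {}H lF la _ IH aF; apply/IH/models_restrict. Qed.

Lemma reach_vars a F H : reach a F H -> vars H \subset vars F.
Proof.
elim=> // {}F l {}H _ _ _ IH; apply: subset_trans IH _; exact: subsetDl.
Qed.

Lemma reach_implied s a F H m : reach a F H -> m.1 \in vars H ->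
  implied s F m -> implied s H m.
Proof.
elim=> // {}F l {}H lF la FH IH mH Fm; apply: IH => //.
apply: implied_restrict => //.
by have := subsetP (reach_vars FH) _ mH; rewrite !inE => /andP[].
Qed.

(** Since the variable of [l] has disappeared in [H], the restriction to [l] occurs somewhere on the
    way, and commutation moves it to the front. *)
Lemma reach_restrict a F H l : models a F -> reach a F H ->
  l.1 \in vars F -> l \in a -> l.1 \notin vars H ->
  reach a (restrict_cnf F l) H.
Proof.
move=> aF FH; elim: FH aF => [{}F aF ->//|{}F m {}H mF ma FH IH aF lF la lH].
case: (eqVneq l.1 m.1) => lm; first by rewrite (models_eq aF mF ma la lm).
have {IH} := IH (models_restrict mF ma aF) _ la lH.
rewrite !inE lm lF restrictC 1?eq_sym // => /(_ isT) IH.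
by apply: (reach_step _ ma IH); rewrite !inE eq_sym lm.
Qed.

(** * Propagation and PPSZ *)

Lemma implication_freeP s F :
  reflect (forall l, ~~ implied s F l) (implication_free s F).
Proof. exact: forallP. Qed.

Lemma propagate_ind s F (P : cnf T -> Prop) :
  (forall G l, implied s G l -> P G -> P (restrict_cnf G l)) ->
  P F -> P (propagate s F).
Proof.
move=> PS PF; rewrite /propagate; elim: #|vars F| => //= n IH.
by case: pickP => // l /PS; apply.
Qed.

Lemma propagate_free s F : implication_free s (propagate s F).
Proof.
(* The induction needs any number of rounds that bounds the number of variables. Each effective
   round removes a variable, and once nothing is implied the iteration is constant. *)
suff free n : forall G, (#|vars G| <= n)%N -> implication_free s
    (iter n (fun F' => if [pick l | implied s F' l] is Some l
                       then restrict_cnf F' l else F') G) by exact: free.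
elim: n => [|n IH] G Gn.
  apply/implication_freeP => l; rewrite /implied.
  by move: Gn; rewrite leqn0 cards_eq0 => /eqP ->; rewrite inE.
rewrite iterSr; case: pickP => [l Gl|noimp].
  case/andP: (Gl) => lG _; apply: IH; rewrite card_vars_restrict //.
  by rewrite -ltnS (leq_trans _ Gn) // prednK //; apply/card_gt0P; exists l.1.
have free : implication_free s G by apply/implication_freeP => l; rewrite noimp.
elim: n {IH Gn} => //= n; case: pickP => // l.
by move=> imp /implication_freeP/(_ l); rewrite imp.
Qed.

Lemma propagate_id s F : implication_free s F -> propagate s F = F.
Proof.
move=> /implication_freeP free; apply: (@propagate_ind s F (fun G => G = F)) => //.
by move=> G l imp GF; move: (free l); rewrite -GF imp.
Qed.

Lemma vars_propagate s F : vars (propagate s F) \subset vars F.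
Proof.
apply: (@propagate_ind s F (fun G => vars G \subset vars F)) => // G l _.
by apply: subset_trans; apply: subsetDl.
Qed.

Lemma reach_propagate s a F : models a F -> reach a F (propagate s F).
Proof.
move=> aF; apply: (@propagate_ind s F (reach a F)); last exact: reach_refl.
move=> G l imp FG; have [lG _] := andP imp; apply: (reach_trans FG (reach1 lG _)).
exact: implied_true (reach_models FG aF) imp.
Qed.

(** A literal implied on the way to [H] would still be implied in [H] if its variable were left
    there. So the path to [H] restricts to it, and that restriction can be done first. *)
Lemma propagate_reach s a F H : models a F -> reach a F H ->
  implication_free s H -> reach a (propagate s F) H.
Proof.
move=> aF FH /implication_freeP Hfree.
suff [] : models a (propagate s F) /\ reach a (propagate s F) H by [].
apply: (@propagate_ind s F (fun G => models a G /\ reach a G H)) => //.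
move=> G l imp [aG GH]; have [lG _] := andP imp.
have la := implied_true aG imp; split; first exact: models_restrict.
by apply: reach_restrict => //; apply: contra (Hfree l) => /(reach_implied GH); apply.
Qed.

Lemma ppsz_guessed_eq s F a b xs :
  {in vars F, forall x, ((x, true) \in a) = ((x, true) \in b)} ->
  ppsz_guessed F a xs s = ppsz_guessed F b xs s.
Proof.
elim: xs F => //= x xs IH F ab.
have {}ab : {in vars (propagate s F), forall x, ((x, true) \in a) = ((x, true) \in b)}.
  by move=> y /(subsetP (vars_propagate s F)); apply: ab.
case: ifP => xF; last exact: IH.
by rewrite -ab // IH // => y; rewrite inE => /andP[_ /ab].
Qed.

Lemma ppsz_guessed_propagate s F a xs :
  ppsz_guessed (propagate s F) a xs s = ppsz_guessed F a xs s.
Proof. by case: xs => //= x xs; rewrite propagate_id // propagate_free. Qed.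

Lemma ppsz_guessed_vars s F a xs : ppsz_guessed F a xs s \subset vars F.
Proof.
elim: xs F => [|x xs IH] F /=; first exact: sub0set.
apply: subset_trans (vars_propagate s F); case: ifP => // xF.
by rewrite subUset sub1set xF (subset_trans (IH _)) // subsetDl.
Qed.

(** Visiting an absent variable only triggers propagation, which the next visit would perform
    anyway. *)
Lemma ppsz_guessed_filter s F a xs y : y \notin vars F ->
  ppsz_guessed F a [seq x <- xs | x != y] s = ppsz_guessed F a xs s.
Proof.
elim: xs F => //= x xs IH F yF.
have yF' : y \notin vars (propagate s F).
  by apply: contra yF; apply: (subsetP (vars_propagate s F)).
case: (eqVneq x y) => [->|xy] /=.
  by rewrite (negbTE yF') IH // ppsz_guessed_propagate.
by rewrite !IH // !inE negb_and yF' orbT.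
Qed.

Lemma models_literal a F x : models a F -> x \in vars F ->
  lit a x \in a.
Proof.
move=> /modelsP[tot _] xF; case: (boolP ((x, true) \in a)) => // xa.
by rewrite tot.
Qed.

(** Both runs proceed in parallel, the formula of the [F] run always reaching that of the [H] run. A
    variable still present in the latter is present in the former and guessed in both; one present
    only in the former has its value already fixed in the latter, so reachability persists. *)
Lemma ppsz_guessed_reach s a F H xs : models a F -> reach a F H ->
  ppsz_guessed H a xs s \subset ppsz_guessed F a xs s.
Proof.
elim: xs F H => //= x xs IH F H aF FH.
have aF' := reach_models (reach_propagate s aF) aF.
have FH' : reach a (propagate s F) (propagate s H).
  apply: propagate_reach (propagate_free s H) => //.
  exact/(reach_trans FH)/reach_propagate/(reach_models FH).
case: ifP => [xH|/negbT xH].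
  have xF := subsetP (reach_vars FH') x xH; rewrite xF setUS //.
  have xa := models_literal aF' xF.
  apply: IH; first exact: models_restrict.
  apply: reach_restrict => //; last by rewrite !inE eqxx.
  exact: reach_trans FH' (reach1 _ _).
case: ifP => [xF|_]; last exact: IH.
have xa := models_literal aF' xF.
apply: subset_trans (IH _ _ _ _) (subsetUr _ _); first exact: models_restrict.
exact: reach_restrict.
Qed.

Lemma ppsz_guessed_restrict s a F l xs : models a F ->
  l.1 \in vars F -> l \in a ->
  ppsz_guessed (restrict_cnf F l) a [seq x <- xs | x != l.1] s
    \subset ppsz_guessed F a xs s.
Proof.
move=> aF lF la; rewrite ppsz_guessed_filter; first exact/ppsz_guessed_reach/reach1.
by rewrite !inE eqxx.
Qed.

(** * Probabilities of being guessed and of being output *)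

Variable R : realType.

(** The orderings are split by their first entry, to condition on the variable that PPSZ visits
    first. *)
Lemma big_permutations V (g : seq T -> R) : V != set0 ->
  \sum_(xs <- permutations (enum V)) g xs =
  \sum_(z in V) \sum_(xs <- permutations (enum (V :\ z))) g (z :: xs).
Proof.
move=> V0; rewrite -[RHS]big_enum -(big_allpairs_dep (h := cons)).
apply/perm_big/uniq_perm; first exact: permutations_uniq.
  apply: allpairs_uniq_dep; first exact: enum_uniq.
    by move=> z _; apply: permutations_uniq.
  by move=> [z xs] [z' xs'] _ _ /= [-> ->].
move=> xs; rewrite mem_permutations; apply/idP/allpairsPdep.
  move=> pxs; have uxs : uniq xs by rewrite (perm_uniq pxs) enum_uniq.
  case: xs pxs uxs => [|z xs] pxs /= => [_|/andP[zxs uxs]].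
    case/set0Pn: V0 => z; rewrite -mem_enum.
    by rewrite -(perm_mem pxs).
  have memV y : (y \in V) = (y == z) || (y \in xs).
    by rewrite -mem_enum -(perm_mem pxs) inE.
  exists z, xs; split=> //; first by rewrite mem_enum memV eqxx.
  rewrite mem_permutations; apply: uniq_perm => // [|y]; first exact: enum_uniq.
  rewrite mem_enum !inE memV; case: (eqVneq y z) => [->|//].
  exact/negbTE.
move=> [z [ys [zV]]]; rewrite mem_enum in zV.
rewrite mem_permutations => pys ->.
apply: uniq_perm => [||y]; last 1 first.
- rewrite inE (perm_mem pys) !mem_enum !inE.
  by case: (eqVneq y z) => [->|].
- by rewrite /= (perm_mem pys) mem_enum !inE eqxx (perm_uniq pys) enum_uniq.
- exact: enum_uniq.
Qed.

(* Each ordering of [V :\ y] arises from [#|V|] orderings of [V] by removing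
   [y]. *)
Lemma big_permutations_filter V y (g : seq T -> R) : y \in V ->
  \sum_(xs <- permutations (enum V)) g [seq x <- xs | x != y] =
  #|V|%:R * \sum_(xs <- permutations (enum (V :\ y))) g xs.
Proof.
move: {2}#|V| (erefl #|V|) => n; elim: n V g => [|n IH] V g cV yV.
  by move: yV; rewrite (cards0_eq cV) inE.
have V0 : V != set0 by apply/set0Pn; exists y.
(* Orderings starting with [y] give one copy of the sum over [V :\ y]; those starting with another
   [z] give [n] copies by induction. *)
rewrite big_permutations // (bigD1 y) //= eqxx.
have cVz z : z \in V -> #|V :\ z| = n by move=> zV; move: cV; rewrite (cardsD1 z) zV => -[].
have -> : \sum_(xs <- permutations (enum (V :\ y))) g [seq x <- xs | x != y] =
    \sum_(xs <- permutations (enum (V :\ y))) g xs.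
  apply: eq_big_seq => xs; rewrite mem_permutations => pxs; congr g.
  apply/all_filterP/allP => z; rewrite (perm_mem pxs) mem_enum !inE.
  by case/andP.
rewrite cV -[n.+1]addn1 natrD mulrDl mul1r addrC; congr (_ + _).
(* Splitting by the first entry requires a nonempty set; if [y] is the only element, [n] is 0 and no
   other [z] exists. *)
case: (eqVneq (V :\ y) set0) => [Vy|Vy].
  have -> : n = 0%N by rewrite -(cVz y) // Vy cards0.
  rewrite mul0r big1 // => z /andP[zV zy].
  by have := in_set0 z; rewrite -Vy !inE zV zy.
rewrite big_permutations // mulr_sumr.
apply: eq_big => [z|z /andP[zV zy]]; first by rewrite !inE andbC.
rewrite zy (IH _ (fun xs => g (z :: xs))) ?cVz //; last by rewrite !inE eq_sym zy.
by congr (_ * _); rewrite !setDDl setUC.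
Qed.

Lemma restrict_assignmentD1 V a l : l.1 \notin V ->
  restrict_assignment V (a :\ l) = restrict_assignment V a.
Proof.
move=> lV; apply/setP => m; rewrite !inE; case: eqVneq => //= ->.
by rewrite (negbTE lV) andbF.
Qed.

(** This form has no division, no restriction of [a] and no case distinction: if [x] is not a
    variable of [F], it is never guessed and both sides vanish. *)
Lemma p_guessedE F x a s :
  (#|vars F| `!)%:R * p_guessed R F x a s =
  \sum_(xs <- permutations (enum (vars F))) (x \in ppsz_guessed F a xs s)%:R.
Proof.
have eq_guessed xs : ppsz_guessed F (restrict_assignment (vars F) a) xs s =
    ppsz_guessed F a xs s.
  by apply: ppsz_guessed_eq => y yF; rewrite inE yF andbT.
rewrite /p_guessed; case: ifPn => xF; last first.
  rewrite mulr0 big1 // => xs _; case: (boolP (x \in ppsz_guessed _ _ _ _)) => //.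
  by move=> /(subsetP (ppsz_guessed_vars _ _ _ _)); rewrite (negbTE xF).
rewrite size_permutations ?enum_uniq // -cardE mulrCA divff ?mulr1; last first.
  by rewrite pnatr_eq0 -lt0n fact_gt0.
rewrite -sum1_count natr_sum big_mkcond; apply: eq_bigr => xs _.
by rewrite eq_guessed; case: ifP.
Qed.

Lemma fact_card_vars F x : x \in vars F ->
  (#|vars F| `!)%:R = #|vars F|%:R * (#|vars F :\ x| `!)%:R :> R.
Proof. by move=> xF; rewrite [#|vars F|](cardsD1 x) xF -natrM. Qed.

Lemma fact_neq0 n : (n`!)%:R != 0 :> R.
Proof. by rewrite pnatr_eq0 -lt0n fact_gt0. Qed.

Lemma p_guessed_out F x a s : x \notin vars F -> p_guessed R F x a s = 0.
Proof. by rewrite /p_guessed => /negbTE ->. Qed.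

(** Deleting [l.1] from a uniform ordering of [vars F] gives a uniform ordering of the remaining
    variables. Under this coupling, a variable guessed after restriction is guessed before it
    too. *)
Lemma p_guessed_restrict_le F x a s l : models a F ->
  l.1 \in vars F -> l \in a ->
  p_guessed R (restrict_cnf F l) x a s <= p_guessed R F x a s.
Proof.
move=> aF lF la; rewrite -(ler_pM2l (x := (#|vars F| `!)%:R)); last first.
  by rewrite lt0r fact_neq0 ler0n.
have -> : (#|vars F| `!)%:R * p_guessed R (restrict_cnf F l) x a s =
    \sum_(xs <- permutations (enum (vars F)))
      (x \in ppsz_guessed (restrict_cnf F l) a [seq y <- xs | y != l.1] s)%:R.
  by rewrite (big_permutations_filter (fun xs =>
    (x \in ppsz_guessed (restrict_cnf F l) a xs s)%:R)) //
    -[vars F :\ l.1]/(vars (restrict_cnf F l)) -p_guessedE mulrA (fact_card_vars lF).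
rewrite p_guessedE; apply: ler_sum => xs _; rewrite ler_nat.
case: (boolP (x \in ppsz_guessed (restrict_cnf F l) _ _ _)) => // xg.
by rewrite (subsetP (ppsz_guessed_restrict s xs aF lF la) _ xg).
Qed.

(** Condition on the first variable [z]. Propagation does nothing at first, so [z] is guessed:
    [z = x] yields the summand 1, and any other [z] leaves a run on the restriction to its literal
    in [a]. In the sum, the term at [x] is 0. *)
Lemma p_guessed_rec F x a s : models a F -> implication_free s F ->
  x \in vars F ->
  \sum_(z in vars F) p_guessed R (restrict_cnf F (lit a z)) x a s + 1 =
  #|vars F|%:R * p_guessed R F x a s.
Proof.
(* Multiplying by the number of orderings with a given first entry turns both sides into counts. *)
move=> aF Ffree xF; apply: (mulfI (fact_neq0 #|vars F :\ x|)).
rewrite mulrA [_ * #|_|%:R]mulrC -fact_card_vars // p_guessedE.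
rewrite big_permutations; last by apply/set0Pn; exists x.
rewrite mulrDr mulr1 mulr_sumr (bigD1 x) //= p_guessed_out ?inE ?eqxx //.
rewrite mulr0 add0r [RHS](bigD1 x) //= [LHS]addrC; congr (_ + _).
  rewrite (eq_bigr (fun=> 1)); last first.
    by move=> xs _ /=; rewrite propagate_id // xF setU11.
  by rewrite big_const_seq count_predT size_permutations ?enum_uniq // -cardE
    iter_addr_0.
apply: eq_bigr => z /andP[zF zx].
have -> : #|vars F :\ x| = #|vars F :\ z|.
  by have := cardsD1 x (vars F); rewrite xF (cardsD1 z) zF => -[].
rewrite -[vars F :\ z]/(vars (restrict_cnf F (lit a z))) p_guessedE.
apply: eq_bigr => xs _ /=; rewrite propagate_id // zF !inE eq_sym.
by rewrite (negbTE zx).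
Qed.

Lemma lift_sat F l b : l.1 \in vars F ->
  b \in sat (restrict_cnf F l) -> l |: b \in sat F.
Proof.
move=> lF; rewrite !inE => /andP[bF bsat].
by rewrite lift_assignment_on //= lift_satisfies.
Qed.

Lemma sat_restrict F l a : l.1 \in vars F -> l \in a ->
  a \in sat F -> a :\ l \in sat (restrict_cnf F l).
Proof.
move=> lF la aF; have := models_sat (models_restrict lF la (sat_models aF)).
suff -> : restrict_assignment (vars (restrict_cnf F l)) a = a :\ l by [].
apply/setP => m; rewrite !inE andbC.
case: (boolP (m \in a)) => ma; last by rewrite !andbF.
have := ma; rewrite (mem_sat _ aF) !andbT => /andP[-> _]; rewrite andbT.
congr negb; apply/eqP/eqP => [ml|-> //].
exact: models_eq (sat_models aF) lF la ma ml.
Qed.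

(** Removing [l] is a bijection from the satisfying assignments containing [l] to those of the
    restriction, with inverse adding [l]. *)
Lemma big_sat_restrict F l (f : assignment T -> R) : l.1 \in vars F ->
  \sum_(a in sat F | l \in a) f (a :\ l) = \sum_(b in sat (restrict_cnf F l)) f b.
Proof.
move=> lF; rewrite (reindex_onto (fun b => l |: b) (fun a => a :\ l)) /=; last first.
  by move=> a /andP[_ la]; rewrite setD1K.
apply: eq_big => [b|b /andP[_ /eqP ->//]].
apply/idP/idP => [/andP[/andP[bF lb] /eqP <-]|bF].
  exact: sat_restrict.
rewrite lift_sat // setU11 /= setU1K //.
by rewrite (mem_sat _ bF) !inE eqxx.
Qed.

Lemma SLP F l : reflect (exists2 a, a \in sat F & l \in a) (l \in SL F).
Proof.
rewrite inE; apply: (iffP andP) => [[lF /set0Pn[b bF]]|[a aF la]].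
  by exists (l |: b); rewrite ?setU11 ?lift_sat.
have lF : l.1 \in vars F by move: la; rewrite (mem_sat _ aF) => /andP[].
by split=> //; apply/set0Pn; exists (a :\ l); apply: sat_restrict.
Qed.

Lemma models_SL F a x : models a F -> x \in vars F -> lit a x \in SL F.
Proof.
move=> aF xF; apply/SLP; exists (restrict_assignment (vars F) a).
  exact: models_sat.
by rewrite inE /= xF andbT; apply: models_literal aF xF.
Qed.

Lemma big_SL_models F a (f : literal T -> R) : models a F ->
  \sum_(l in SL F | l \in a) f l = \sum_(z in vars F) f (lit a z).
Proof.
move=> aF; rewrite (reindex_onto (fun z => lit a z) fst) /=.
  apply: eq_bigl => z; rewrite eqxx andbT.
  apply/andP/idP => [[]|zF]; first by rewrite inE => /andP[].
  by split; [apply: models_SL | apply: models_literal aF zF].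
move=> l /andP[]; rewrite inE => /andP[lF _] la.
exact: models_eq aF lF la (models_literal aF lF) _.
Qed.

Lemma SL_restrict F l m : l.1 \in vars F -> m \in SL (restrict_cnf F l) ->
  m \in SL F.
Proof.
move=> lF /SLP[b bF mb]; apply/SLP; exists (l |: b); first exact: lift_sat.
by rewrite inE mb orbT.
Qed.

Lemma card_SL_restrict F l : l \in SL F ->
  (#|SL (restrict_cnf F l)| < #|SL F|)%N.
Proof.
move=> lSL; apply/proper_card/properP; split; last first.
  by exists l; rewrite // !inE eqxx.
by apply/subsetP => m; apply: SL_restrict; move: lSL; rewrite inE => /andP[].
Qed.

Lemma asl_prob_notsub n F b a : ~~ (b \subset a) -> asl_prob R n F b a = 0.
Proof.
elim: n F b => [|n IH] F b ba /=.
  by case: eqP ba => // ->; rewrite subxx.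
rewrite big1 ?mul0r // => l _; apply: IH; apply: contra ba => /(subset_trans _) -> //.
exact: subsetUr.
Qed.

Lemma asl_prob_setU1 n F l b a : l.1 \notin vars F -> l \notin b -> l \in a ->
  asl_prob R n F (l |: b) a = asl_prob R n F b (a :\ l).
Proof.
elim: n F b => [|n IH] F b lF lb la /=.
  congr (nat_of_bool _)%:R; apply/eqP/eqP => [<-|->]; first by rewrite setU1K.
  by rewrite setD1K.
congr (_ / _); apply: eq_bigr => m; rewrite inE => /andP[mF _].
rewrite setUCA; apply: IH => //; first by rewrite !inE (negbTE lF) andbF.
by rewrite !inE (negbTE lb) orbF; apply: contraNneq lF => ->.
Qed.

Lemma asl_prob_ge0 n F b a : 0 <= asl_prob R n F b a.
Proof.
elim: n F b => [|n IH] F b /=; first exact: ler0n.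
by rewrite divr_ge0 // sumr_ge0.
Qed.

(** Condition on the first chosen literal: one outside [a] makes the output [a] impossible, and [a]
    has one literal for each variable. *)
Lemma p_asl_rec F a : models a F ->
  #|SL F|%:R * p_asl R F a = \sum_(z in vars F) p_asl R (restrict_cnf F (lit a z)) a.
Proof.
move=> aF; rewrite -(big_SL_models (fun l => p_asl R (restrict_cnf F l) a)) //.
case: (set_0Vmem (vars F)) => [F0|[x xF]].
  have -> : SL F = set0 by apply/setP => l; rewrite !inE F0 inE.
  by rewrite cards0 mul0r big_pred0 // => l; rewrite inE.
have SL_neq0 : #|SL F|%:R != 0 :> R.
  by rewrite pnatr_eq0 -lt0n; apply/card_gt0P; exists (lit a x); apply: models_SL.
rewrite /p_asl; case cF : #|vars F| => [|n]; first by rewrite (cards0_eq cF) inE in xF.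
rewrite /= mulrC divfK // big_mkcondr; apply: eq_bigr => l.
rewrite inE => /andP[lF _]; case: ifPn => la; last first.
  by apply: asl_prob_notsub; rewrite setU0 sub1set inE (negbTE la).
rewrite asl_prob_setU1 /= ?inE ?eqxx ?la ?lF //.
have -> : #|vars F :\ l.1| = n by move: cF; rewrite (cardsD1 l.1) lF => -[].
congr asl_prob; apply/setP => m; rewrite !inE.
case: (boolP (m \in a)) => ma; last by rewrite andbF.
rewrite /=; congr (~~ _ && _); apply/eqP/eqP => [-> //|].
exact: models_eq aF lF la ma.
Qed.

Lemma p_aslD1 F a l : l.1 \notin vars F -> p_asl R F (a :\ l) = p_asl R F a.
Proof. by move=> lF; rewrite /p_asl restrict_assignmentD1. Qed.

Lemma p_guessedD1 F x a l s : l.1 \notin vars F ->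
  p_guessed R F x (a :\ l) s = p_guessed R F x a s.
Proof. by move=> lF; rewrite /p_guessed restrict_assignmentD1. Qed.

Lemma notin_vars_restrict F l : l.1 \notin vars (restrict_cnf F l).
Proof. by rewrite !inE eqxx. Qed.

(** Expand [p_asl R F a] by its first choice. The choice of [l] gives
    [p_asl R (restrict_cnf F l) a]; for the other choices, induction and commutation bound the sum
    by the expansion of the same quantity. Since restriction loses at least [l] from [SL], the
    resulting factor is at most [#|SL F|]. *)
Lemma p_asl_restrict_ge F a l : models a F -> l.1 \in vars F -> l \in a ->
  p_asl R F a <= p_asl R (restrict_cnf F l) a.
Proof.
move: {2}#|vars F| (erefl #|vars F|) => n.
elim: n F l => [|n IH] F l cF aF lF la; first by rewrite (cards0_eq cF) inE in lF.
have lE : l = lit a l.1.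
  exact: (models_eq (l := lit a l.1) aF lF (models_literal aF lF) la).
have lSL : l \in SL F by rewrite lE; apply: models_SL.
suff le : #|SL F|%:R * p_asl R F a <=
    (#|SL (restrict_cnf F l)|.+1)%:R * p_asl R (restrict_cnf F l) a.
  have SL_gt0 : 0 < #|SL F|%:R :> R.
    by rewrite ltr0n; apply/card_gt0P; exists l.
  rewrite -(ler_pM2l SL_gt0); apply: le_trans le _.
  by rewrite ler_wpM2r ?asl_prob_ge0 // ler_nat card_SL_restrict.
rewrite -addn1 natrD mulrDl mul1r addrC p_asl_rec // p_asl_rec; last exact: models_restrict.
rewrite (bigD1 l.1) //= -lE lerD2l.
rewrite [leRHS](eq_bigl (fun z => (z \in vars F) && (z != l.1))); last first.
  by move=> z; rewrite !inE andbC.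
apply: ler_sum => z /andP[zF zl]; rewrite restrictC 1?eq_sym //.
have za := models_literal aF zF.
apply: IH => //; last 2 first.
- exact: models_restrict.
- by rewrite !inE eq_sym zl.
by rewrite card_vars_restrict // cF.
Qed.

Lemma p_asl_sum F : satisfiable F -> \sum_(a in sat F) p_asl R F a = 1.
Proof.
move: {2}#|vars F| (erefl #|vars F|) => n.
elim: n F => [|n IH] F cF Fsat.
  have F0 := cards0_eq cF; case/set0Pn: (Fsat) => a aF.
  (* Without variables the empty assignment is the only satisfying one, and it is output with
     certainty. *)
  have memF b : b \in sat F -> b = set0.
    by move=> bF; apply/setP => l; rewrite (mem_sat _ bF) F0 !inE.
  rewrite (big_pred1 set0) => [|b]; last first.
    by apply/idP/eqP => [/memF //|->]; rewrite -(memF a).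
  rewrite /p_asl cF /= (_ : restrict_assignment _ _ = set0) ?eqxx //.
  by apply/setP => l; rewrite !inE.
have /set0Pn[a aF] := Fsat.
have [x xF] : exists x, x \in vars F by apply/card_gt0P; rewrite cF.
have SL_neq0 : #|SL F|%:R != 0 :> R.
  rewrite pnatr_eq0 -lt0n; apply/card_gt0P; exists (lit a x).
  by apply: models_SL => //; apply: sat_models.
apply: (mulfI SL_neq0); rewrite mulr1 mulr_sumr.
under eq_bigr => b bF.
  rewrite p_asl_rec ?sat_models //.
  rewrite -(big_SL_models (fun l => p_asl R (restrict_cnf F l) b)) ?sat_models //.
  over.
(* For a fixed first literal [l], the assignments containing [l] correspond to those satisfying the
   restriction, whose probabilities sum to 1 by induction. *)
rewrite (exchange_big_dep (mem (SL F))) /=; last by move=> b l _ /andP[].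
rewrite -sumr_const; apply: eq_bigr => l lSL.
have /andP[lF Flsat] : (l.1 \in vars F) && satisfiable (restrict_cnf F l).
  by move: lSL; rewrite inE.
rewrite -(IH (restrict_cnf F l)) //; last by rewrite card_vars_restrict // cF.
rewrite -big_sat_restrict //; apply: eq_big => [b|b _]; first by rewrite lSL.
by rewrite p_aslD1 // notin_vars_restrict.
Qed.

(** * Costs of the restrictions *)

Lemma frozenP F x : x \in vars F ->
  reflect {in sat F &, forall a b, ((x, true) \in a) = ((x, true) \in b)}
          (frozen F x).
Proof.
move=> xF; rewrite /frozen xF; apply: (iffP forall_inP) => eq_sat a.
  by move=> b aF bF; apply/eqP; move: b bF; apply/forall_inP/eq_sat.
by move=> aF; apply/forall_inP => b bF; apply/eqP/eq_sat.
Qed.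

Lemma frozen_restrict F l x : l.1 \in vars F ->
  x \in vars (restrict_cnf F l) -> frozen F x -> frozen (restrict_cnf F l) x.
Proof.
move=> lF xFl fx; have xF : x \in vars F by case/andP: fx.
apply/frozenP => // a b /(lift_sat lF) aF /(lift_sat lF) bF.
have := frozenP xF fx _ _ aF bF; rewrite !inE.
suff /negbTE -> : (x, true) != l by [].
by move: xFl; rewrite !inE => /andP[xl _]; apply: contraNneq xl => <-.
Qed.

Lemma cost_var_frozen s (S : R) F x : frozen F x -> satisfiable F ->
  implication_free s F ->
  \sum_(l in SL F) cost_var s S (restrict_cnf F l) x <=
  #|SL F|%:R * cost_var s S F x - 1.
Proof.
move=> fx Fsat Ffree; have xF : x \in vars F by case/andP: fx.
(* Exchange the choice of [l] with the satisfying assignment. If [l] is over [x], the cost is 0,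
   matching [p_guessed] being 0 there; otherwise [x] stays frozen. *)
have -> : \sum_(l in SL F) cost_var s S (restrict_cnf F l) x =
    \sum_(a in sat F) \sum_(z in vars F)
      p_asl R (restrict_cnf F (lit a z)) a *
      p_guessed R (restrict_cnf F (lit a z)) x a s.
  under [RHS]eq_bigr => a aF.
    rewrite -(big_SL_models (fun l =>
      p_asl R (restrict_cnf F l) a * p_guessed R (restrict_cnf F l) x a s));
      last exact: sat_models.
    over.
  rewrite (exchange_big_dep (mem (SL F))) /=; last by move=> a l _ /andP[].
  apply: eq_bigr => l lSL.
  have lF : l.1 \in vars F by move: lSL; rewrite inE => /andP[].
  transitivity (\sum_(b in sat (restrict_cnf F l))
    p_asl R (restrict_cnf F l) b * p_guessed R (restrict_cnf F l) x b s).
    rewrite /cost_var; case: ifP => [xFl|/negbFE xFl].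
      by rewrite big1 // => b _; rewrite p_guessed_out // mulr0.
    by rewrite frozen_restrict.
  rewrite -big_sat_restrict //; apply: eq_big => [a|a _]; first by rewrite lSL.
  by rewrite p_aslD1 ?p_guessedD1 // notin_vars_restrict.
rewrite /cost_var xF /= fx mulr_sumr -[X in _ - X](p_asl_sum Fsat) -sumrB.
apply: ler_sum => a aF; have aM := sat_models aF.
rewrite mulrA p_asl_rec // lerBrDl -lerBrDr mulr_suml -sumrB.
(* The drops of [p_guessed] sum to 1 by [p_guessed_rec]. *)
have -> : p_asl R F a = \sum_(z in vars F) p_asl R F a *
    (p_guessed R F x a s - p_guessed R (restrict_cnf F (lit a z)) x a s).
  rewrite -mulr_sumr sumrB sumr_const -mulr_natl -p_guessed_rec //.
  by rewrite addrAC subrr add0r mulr1.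
apply: ler_sum => z zF; have za := models_literal aM zF.
rewrite -mulrBr ler_wpM2r ?p_asl_restrict_ge //.
by rewrite subr_ge0 p_guessed_restrict_le.
Qed.

Lemma restrict_kcnf k F l : is_kcnf k F -> is_kcnf k (restrict_cnf F l).
Proof.
move=> /forall_inP Fk; apply/forall_inP => C /imsetP[D]; rewrite inE => /andP[DF _] ->.
by apply: leq_trans (Fk D DF); apply/subset_leq_card/subsetDl.
Qed.

(** The cost of a frozen variable is an average, with weights [p_asl], of probabilities bounded by
    [S]. This covers non-frozen variables that become frozen under restriction. *)
Lemma cost_var_le k s (S : R) F x : guess_bound k s S -> is_kcnf k F ->
  satisfiable F -> x \in vars F -> cost_var s S F x <= S.
Proof.
move=> [_ bound] Fk Fsat xF; rewrite /cost_var xF /=; case: ifP => // fx.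
rewrite -[leRHS]mul1r -(p_asl_sum Fsat) mulr_suml; apply: ler_sum => a aF.
by rewrite ler_wpM2l ?asl_prob_ge0 // bound.
Qed.

Lemma nonfrozen_SL F x c : x \in vars F -> ~~ frozen F x -> (x, c) \in SL F.
Proof.
move=> xF; rewrite /frozen xF negb_forall_in => /exists_inP[a aF].
rewrite negb_forall_in => /exists_inP[b bF ab].
have xaF := models_SL (sat_models aF) xF.
have xbF := models_SL (sat_models bF) xF.
by case: c; move: ab xaF xbF; case: (_ \in a); case: (_ \in b).
Qed.

Lemma cost_var_nonfrozen k s (S : R) F x : guess_bound k s S -> is_kcnf k F ->
  x \in vars F -> ~~ frozen F x ->
  \sum_(l in SL F) cost_var s S (restrict_cnf F l) x <=
  #|SL F|%:R * cost_var s S F x - 2 * S.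
Proof.
move=> bound Fk xF nfx; rewrite {2}/cost_var xF (negbTE nfx) /=.
have xSL c := nonfrozen_SL c xF nfx.
rewrite (bigD1 (x, true)) //= (bigD1 (x, false)) /=; last by rewrite xSL xpair_eqE andbF.
have cost0 c : cost_var s S (restrict_cnf F (x, c)) x = 0.
  by rewrite /cost_var !inE eqxx.
rewrite !cost0 !add0r.
pose SL' l := (l \in SL F) && (l != (x, true)) && (l != (x, false)).
(* Two of the literals in [SL F] are over [x]; each of the others contributes at most [S]. *)
have -> : #|SL F|%:R * S - 2 * S = \sum_(l | SL' l) S.
  rewrite sumr_const -[RHS]mulr_natl -mulrBl; congr (_ * _).
  have -> : #|SL F| = (2 + #|SL'|)%N; last by rewrite natrD addrAC subrr add0r.
  rewrite (cardsD1 (x, true)) (cardsD1 (x, false) (_ :\ _)).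
  rewrite in_setD1 !xSL xpair_eqE andbF /=; congr (_ + (_ + _))%N.
  apply: eq_card => l; rewrite !in_setD1 [in RHS]unfold_in /SL'.
  by rewrite andbC [_ && (_ \in _)]andbC.
apply: ler_sum => l /andP[/andP[lSL lt] lf].
have := lSL; rewrite inE => /andP[lF Flsat].
apply: cost_var_le bound (restrict_kcnf _ Fk) Flsat _; rewrite !inE xF andbT.
apply/eqP => xl; move: lt lf; rewrite [l]surjective_pairing -xl.
by case: (l.2); rewrite eqxx.
Qed.

(** Summing over [vars F] gives an index set independent of [l], so that the sums over literals and
    variables can be exchanged. *)
Lemma cost_restrict s (S : R) F l :
  cost s S (restrict_cnf F l) = \sum_(x in vars F) cost_var s S (restrict_cnf F l) x.
Proof.
rewrite /cost [RHS](bigID (mem (vars (restrict_cnf F l)))) /= [X in _ + X]big1.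
  rewrite addr0; apply: eq_bigl => x; rewrite /= !inE andbA.
  by case: (x \in vars F); rewrite ?andbF.
by move=> x /andP[_ xFl]; rewrite /cost_var xFl.
Qed.

End Restriction_costs.

Theorem theorem6 (R : realType) (k s : nat) (S : R) (T : finType) (F : cnf T)
    (hk : (3 <= k)%N) (hS : guess_bound k s S)
    (hFk : is_kcnf k F) (hFsat : satisfiable F) (hFfree : implication_free s F) :
  expect_SL F (fun l => cost s S (restrict_cnf F l))
  <= cost s S F
     - (nN F)%:R * (2 * S / #|SL F|%:R)
     - (nC F)%:R * (1 / #|SL F|%:R).
Proof.
rewrite /expect_SL.
(* This is the claim multiplied by [#|SL F|], which splits into one inequality per variable. *)
have le : \sum_(l in SL F) cost s S (restrict_cnf F l) <=
    #|SL F|%:R * cost s S F - (nN F)%:R * (2 * S) - (nC F)%:R.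
  under eq_bigr => l _ do rewrite cost_restrict.
  rewrite exchange_big /= /cost mulr_sumr.
  have -> : (nN F)%:R * (2 * S) = \sum_(x in vars F | ~~ frozen F x) (2 * S).
    rewrite sumr_const mulr_natl; congr (_ *+ _).
    by apply: eq_card => x; rewrite !inE.
  have -> : (nC F)%:R = \sum_(x in vars F | frozen F x) 1 :> R.
    rewrite sumr_const; congr (_ *+ _).
    by apply: eq_card => x; rewrite !inE.
  rewrite -addrA -opprD 2!big_mkcondr -big_split -sumrB.
  apply: ler_sum => x xF /=.
  case: (boolP (frozen F x)) => fx /=; rewrite ?add0r ?addr0.
    exact: cost_var_frozen.
  exact: cost_var_nonfrozen hS hFk xF fx.
(* If [SL F] is empty, satisfiability forces [F] to have no variables; the cost is then 0, and so is
   every quotient, as the inverse of 0 is 0. *)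
have [SL0|SL_gt0] := posnP #|SL F|.
  suff F0 : vars F = finset.set0.
    by rewrite SL0 !invr0 !mulr0 !subr0 /cost F0 big_set0.
  apply/setP => x; rewrite inE; apply: contraTF isT => xF.
  have /set0Pn[a /sat_models aF] := hFsat.
  by have := models_SL aF xF; rewrite (cards0_eq SL0) inE.
rewrite ler_pdivrMr ?ltr0n // mulrBl mulrBl -!mulrA mulVf ?pnatr_eq0 -?lt0n //.
by rewrite !mulr1 [_ * #|_|%:R]mulrC.
Qed.
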